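(* Let $p\in\mathbb{N}^k$ and $q\in\mathbb{N}^\ell$ with $m=\sum_{i=1}^k p_i$ and $n=\sum_{j=1}^\ell q_j$, let $\sigma\in\{0,1\}^{k\times \ell}$ be a block sparsity structure, and let $\bar\sigma:=I_\ell\in\{0,1\}^{\ell\times\ell}$. The data $(U_-,X)$ are informative for quadratic stabilization with feedback gain $K\in\mathcal{M}_{p,q}^\sigma$ and Lyapunov matrix $0<P\in\mathcal{M}_{q,q}^{\bar\sigma}$ if and only if there exist $0<P\in\mathcal{M}_{q,q}^{\bar\sigma}$, $L\in\mathcal{M}_{p,q}^\sigma$, $\alpha\geq 0$ and $\beta>0$ such that $$\begin{bmatrix} P-\beta I & 0 & BL\\ 0 & 0 & P\\ L^\top B^\top & P & P\end{bmatrix}-\alpha\begin{bmatrix} N & 0\\ 0 & 0\end{bmatrix}\geq 0,$$ where $N\in\mathbb{R}^{2n\times 2n}$ occupies the upper-left $2n\times 2n$ block.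
   Context: All matrices are real; $P>0$ (resp. $\geq 0$, $<0$) means symmetric positive definite (resp. positive semidefinite, negative definite). System: $x(t+1)=A_sx(t)+Bu(t)+w(t)$ with $x(t),w(t)\in\mathbb{R}^n$, $u(t)\in\mathbb{R}^m$. It is the aggregate of $r$ agents with state and input dimensions $n_i,m_i$ ($n=\sum n_i$, $m=\sum m_i$), and $B=\mathrm{diag}(B_1,\dots,B_r)\in\mathbb{R}^{n\times m}$ with $B_i\in\mathbb{R}^{n_i\times m_i}$. $B$ is known, $A_s\in\mathbb{R}^{n\times n}$ is unknown. Data: on a time window of length $T$ one measures $X=[x(0)\ \cdots\ x(T)]$ and $U_-=[u(0)\ \cdots\ u(T-1)]$; set $X_+=[x(1)\ \cdots\ x(T)]$, $X_-=[x(0)\ \cdots\ x(T-1)]$. The noise matrix $W_-=[w(0)\ \cdots\ w(T-1)]$ is not measured, but is assumed to satisfy $$\begin{bmatrix} I\\ W_-^\top\end{bmatrix}^\top\Phi\begin{bmatrix} I\\ W_-^\top\end{bmatrix}\geq 0,\qquad \Phi=\begin{bmatrix}\Phi_{11}&\Phi_{12}\\ \Phi_{12}^\top&\Phi_{22}\end{bmatrix}\qquad( * )$$ for a given matrix $\Phi$ with $\Phi_{11}=\Phi_{11}^\top\in\mathbb{R}^{n\times n}$, $\Phi_{12}\in\mathbb{R}^{n\times T}$, $\Phi_{22}=\Phi_{22}^\top\in\mathbb{R}^{T\times T}$, $\Phi_{22}<0$. The data are generated by the true system $(A_s,B)$ with noise satisfying $( * )$. The set of state matrices compatible with the data is $\Sigma=\{A\in\mathbb{R}^{n\times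 n}\mid W_-=X_+-AX_--BU_-\text{ satisfies }( * )\}$; in particular $A_s\in\Sigma$. Define $$N:=\begin{bmatrix} I & X_+-BU_-\\ 0&-X_-\end{bmatrix}\Phi\begin{bmatrix} I & X_+-BU_-\\ 0&-X_-\end{bmatrix}^\top .$$ Block structures: for $p\in\mathbb{N}^k$, $q\in\mathbb{N}^\ell$ with $m=\sum p_i$, $n=\sum q_j$, a matrix $M\in\mathbb{R}^{m\times n}$ is partitioned into blocks $M_{ij}\in\mathbb{R}^{p_i\times q_j}$, $1\le i\le k$, $1\le j\le\ell$. A block sparsity structure is a matrix $\sigma\in\{0,1\}^{k\times\ell}$, and $\mathcal{M}_{p,q}^\sigma:=\{M\in\mathbb{R}^{m\times n}\mid M_{ij}=0\text{ if }\sigma_{ij}=0\}$. In particular $\mathcal{M}_{q,q}^{\bar\sigma}$ with $\bar\sigma=I_\ell$ is the set of $n\times n$ block diagonal matrices with diagonal blocks of sizes $q_1,\dots,q_\ell$. Definition: the data $(U_-,X)$ are informative for quadratic stabilization with feedback gain $K\in\mathcal{M}_{p,q}^\sigma$ and Lyapunov matrix $0<P\in\mathcal{M}_{q,q}^{\bar\sigma}$ if there exist $K\in\mathcal{M}_{p,q}^\sigma$ and a matrix $P\in\mathcal{M}_{q,q}^{\bar\sigma}$ with $P>0$ such that $(A+BK)P(A+BK)^\top<P$ for every $A\in\Sigma$. *)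

(* Defs.v *)
From HB Require Import structures.
From mathcomp Require Import all_boot all_order all_algebra.
From mathcomp Require Import reals.

Set Implicit Arguments.
Unset Strict Implicit.
Unset Printing Implicit Defensive.

Import Order.TTheory GRing.Theory Num.Theory.
Local Open Scope ring_scope.

Definition posdef (R : realType) (n : nat) (A : 'M[R]_n) : Prop :=
  A^T = A /\ forall v : 'cV[R]_n, v != 0 -> 0 < (v^T *m A *m v) 0 0.

Definition possemidef (R : realType) (n : nat) (A : 'M[R]_n) : Prop :=
  A^T = A /\ forall v : 'cV[R]_n, 0 <= (v^T *m A *m v) 0 0.

Definition negdef (R : realType) (n : nat) (A : 'M[R]_n) : Prop :=
  posdef (- A).

Definition signal_mx (R : realType) (n k : nat) (s : nat -> 'cV[R]_n) :
    'M[R]_(n, k) :=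
  \matrix_(i < n, t < k) s t i 0.

(* X = [x(0) ... x(T)]: dropping the first (last) column gives X_+ (X_-). *)
Definition Xplus (R : realType) (n T : nat) (X : 'M[R]_(n, T.+1)) :
    'M[R]_(n, T) := col' ord0 X.

Definition Xminus (R : realType) (n T : nat) (X : 'M[R]_(n, T.+1)) :
    'M[R]_(n, T) := col' ord_max X.

(* diag(B_1, ..., B_r) with rectangular blocks. On the diagonal the two
   dimension pairs agree, so [conform_mx 0 (D i)] is [D i] there. *)
Definition block_diag (R : realType) (r : nat) (a b : 'I_r -> nat)
    (D : forall i : 'I_r, 'M[R]_(a i, b i)) :
    'M[R]_(\sum_(i < r) a i, \sum_(i < r) b i) :=
  \mxblock_(i < r, j < r)
    (if i == j then conform_mx (0 : 'M[R]_(a i, b j)) (D i) else 0).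

Definition structured (R : realType) (k l m n : nat)
    (p : 'I_k -> nat) (q : 'I_l -> nat)
    (hp : m = (\sum_(i < k) p i)%N) (hq : n = (\sum_(j < l) q j)%N)
    (sigma : 'M[bool]_(k, l)) (M : 'M[R]_(m, n)) : Prop :=
  forall (i : 'I_k) (j : 'I_l),
    sigma i j = false -> submxblock (castmx (hp, hq) M) i j = 0.

Definition id_structure (l : nat) : 'M[bool]_l := \matrix_(i, j) (i == j).

Definition noise_mx (R : realType) (n T : nat) (Phi11 : 'M[R]_n)
    (Phi12 : 'M[R]_(n, T)) (Phi22 : 'M[R]_T) : 'M[R]_(n + T) :=
  block_mx Phi11 Phi12 Phi12^T Phi22.

Definition noise_bound (R : realType) (n T : nat) (Phi : 'M[R]_(n + T))
    (W : 'M[R]_(n, T)) : Prop :=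
  possemidef ((col_mx 1%:M W^T)^T *m Phi *m col_mx 1%:M W^T).

Definition compatible (R : realType) (n m T : nat) (B : 'M[R]_(n, m))
    (Phi : 'M[R]_(n + T)) (U : 'M[R]_(m, T)) (X : 'M[R]_(n, T.+1))
    (A : 'M[R]_n) : Prop :=
  noise_bound Phi (Xplus X - A *m Xminus X - B *m U).

Definition data_mx (R : realType) (n m T : nat) (B : 'M[R]_(n, m))
    (Phi : 'M[R]_(n + T)) (U : 'M[R]_(m, T)) (X : 'M[R]_(n, T.+1)) :
    'M[R]_(n + n) :=
  let F : 'M[R]_(n + n, n + T) :=
    block_mx 1%:M (Xplus X - B *m U) 0 (- Xminus X) in
  F *m Phi *m F^T.

Definition informative (R : realType) (k l n m T : nat)
    (p : 'I_k -> nat) (q : 'I_l -> nat)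
    (hp : m = (\sum_(i < k) p i)%N) (hq : n = (\sum_(j < l) q j)%N)
    (sigma : 'M[bool]_(k, l)) (B : 'M[R]_(n, m)) (Phi : 'M[R]_(n + T))
    (U : 'M[R]_(m, T)) (X : 'M[R]_(n, T.+1)) : Prop :=
  exists (K : 'M[R]_(m, n)) (P : 'M[R]_n),
    [/\ structured hp hq sigma K,
        structured hq hq (id_structure l) P,
        posdef P
      & forall A : 'M[R]_n, compatible B Phi U X A ->
          posdef (P - (A + B *m K) *m P *m (A + B *m K)^T)].

Definition lmi_mx (R : realType) (n m : nat) (B : 'M[R]_(n, m))
    (N : 'M[R]_(n + n)) (P : 'M[R]_n) (L : 'M[R]_(m, n)) (alpha beta : R) :
    'M[R]_(n + n + n) :=
  block_mx (block_mx (P - beta%:M) 0 0 0 : 'M[R]_(n + n)) (col_mx (B *m L) P)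
           (row_mx (L^T *m B^T) P)                        P
  - alpha *: block_mx N 0 0 0.

(* Main.v *)
Require Import Defs.
From mathcomp Require Import all_boot all_order all_algebra.
From mathcomp Require Import reals.
From mathcomp Require Import boolp classical_sets functions.
From mathcomp Require Import topology normedtype derive.
From mathcomp Require Import ring lra.

Set Implicit Arguments.
Unset Strict Implicit.
Unset Printing Implicit Defensive.

Import Order.TTheory GRing.Theory Num.Theory.
Import numFieldNormedType.Exports.
Local Open Scope ring_scope.

(** Put L = K P.  On vectors (v, y, g) the matrix of the LMI has the value

      v'Pv - h'Ph - alpha N(v, y) - beta v'v + (g + h)'P(g + h),

    where h = (BK)'v + y ([lmi_form]).  Minimizing over g, that is g = - h,
    shows that the LMI says  M(v, y) >= alpha N(v, y) + beta v'v  for the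
    form  M(v, y) = v'Pv - h'Ph.  At y = A'v, the number M(v, A'v) is the value
    at v of P - (A+BK)P(A+BK)', while N(v, A'v) >= 0 for all v says exactly that
    A is compatible with the data ([compatibleE], [bil_qmi]).  So the LMI
    gives stability of all compatible systems ([lmi_stabilizes]).

    Conversely, suppose that K and P stabilize every compatible A.  Then X_- has
    full row rank ([stabilized_unexcited]): if y'X_- = 0, then A_s + s y y' is
    compatible for every real s, and for y <> 0 the Lyapunov inequality cannot
    hold for both signs of s.  Hence the lower right block X_- Phi22 X_-' of N
    is negative definite, so that N(v, y) >= 0 implies y = A'v for some
    compatible A ([qmi_interpolation]).  Therefore M > 0 wherever N >= 0, off
    the origin, and a strict S-lemma ([strict_s_lemma]) supplies alpha and beta.

    In the S-lemma, N need not be positive anywhere: if N <= 0, the condition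
    M > 0 constrains only the kernel of N.  Compactness of the unit sphere
    ([cone_gap]) allows M to be lowered and N to be raised by a small multiple of
    the identity.  The raised N is positive wherever N vanishes off the origin,
    and the S-lemma with non-strict inequalities ([s_lemma_nonstrict]) applies.

    The change of variables K = L P^-1 preserves the sparsity of K because the
    inverse of a block diagonal matrix is block diagonal
    ([structured_invmx]). *)

(** * Bilinear forms of matrices *)

Definition bil (R : realType) (m n : nat) (A : 'M[R]_(m, n))
    (u : 'cV[R]_m) (v : 'cV[R]_n) : R := (u^T *m A *m v) 0 0.

Section Bilinear.
Variable R : realType.
Implicit Types m n p q : nat.

Lemma bilE m n (A : 'M[R]_(m, n)) u v :
  bil A u v = \sum_(j < n) (\sum_(i < m) u i 0 * A i j) * v j 0.
Proof.
rewrite /bil mxE; apply: eq_bigr => j _; rewrite mxE; congr (_ * _).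
by apply: eq_bigr => i _; rewrite mxE.
Qed.

Lemma bilDl m n (A : 'M[R]_(m, n)) u1 u2 v :
  bil A (u1 + u2) v = bil A u1 v + bil A u2 v.
Proof. by rewrite /bil linearD /= !mulmxDl mxE. Qed.

Lemma bilDr m n (A : 'M[R]_(m, n)) u v1 v2 :
  bil A u (v1 + v2) = bil A u v1 + bil A u v2.
Proof. by rewrite /bil mulmxDr mxE. Qed.

Lemma bilZl m n (A : 'M[R]_(m, n)) a u v : bil A (a *: u) v = a * bil A u v.
Proof. by rewrite /bil linearZ /= -!scalemxAl mxE. Qed.

Lemma bilZr m n (A : 'M[R]_(m, n)) a u v : bil A u (a *: v) = a * bil A u v.
Proof. by rewrite /bil -scalemxAr mxE. Qed.

Lemma bilNl m n (A : 'M[R]_(m, n)) u v : bil A (- u) v = - bil A u v.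
Proof. by rewrite -scaleN1r bilZl mulN1r. Qed.

Lemma bilNr m n (A : 'M[R]_(m, n)) u v : bil A u (- v) = - bil A u v.
Proof. by rewrite -scaleN1r bilZr mulN1r. Qed.

Lemma bil0l m n (A : 'M[R]_(m, n)) v : bil A 0 v = 0.
Proof. by rewrite -(scale0r 0) bilZl mul0r. Qed.

Lemma bil_addmx m n (A B : 'M[R]_(m, n)) u v :
  bil (A + B) u v = bil A u v + bil B u v.
Proof. by rewrite /bil mulmxDr mulmxDl mxE. Qed.

Lemma bil_scalemx m n a (A : 'M[R]_(m, n)) u v :
  bil (a *: A) u v = a * bil A u v.
Proof. by rewrite /bil -scalemxAr -scalemxAl mxE. Qed.

Lemma bil_scalar_mx n a (u v : 'cV[R]_n) :
  bil a%:M u v = a * bil 1%:M u v.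
Proof. by rewrite -[a%:M]scalemx1 bil_scalemx. Qed.

Lemma bil_oppmx m n (A : 'M[R]_(m, n)) u v : bil (- A) u v = - bil A u v.
Proof. by rewrite -scaleN1r bil_scalemx mulN1r. Qed.

Lemma bil_zeromx m n u v : bil (0 : 'M[R]_(m, n)) u v = 0.
Proof. by rewrite -(scale0r 0) bil_scalemx mul0r. Qed.

Lemma bil_mulmxl m n p (A : 'M[R]_(m, n)) (B : 'M_(n, p)) u v :
  bil (A *m B) u v = bil B (A^T *m u) v.
Proof. by rewrite /bil trmx_mul trmxK !mulmxA. Qed.

Lemma bil_mulmxr m n p (A : 'M[R]_(m, n)) (B : 'M_(n, p)) u v :
  bil (A *m B) u v = bil A u (B *m v).
Proof. by rewrite /bil !mulmxA. Qed.

Lemma bil_trmx m n (A : 'M[R]_(m, n)) u v : bil A^T u v = bil A v u.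
Proof.
have -> : bil A v u = (v^T *m A *m u)^T 0 0 by rewrite mxE.
by rewrite /bil !trmx_mul trmxK mulmxA.
Qed.

Lemma bil_sym n (A : 'M[R]_n) u v : A^T = A -> bil A u v = bil A v u.
Proof. by move=> sA; rewrite -{1}sA bil_trmx. Qed.

Lemma bil_block m n p q (A : 'M[R]_(m, p)) (B : 'M_(m, q)) (C : 'M_(n, p))
    (D : 'M_(n, q)) u1 u2 v1 v2 :
  bil (block_mx A B C D) (col_mx u1 u2) (col_mx v1 v2)
  = bil A u1 v1 + bil B u1 v2 + bil C u2 v1 + bil D u2 v2.
Proof.
rewrite /bil tr_col_mx mul_row_block mul_row_col !mulmxDl !mxE.
by rewrite -!addrA; congr (_ + _); rewrite addrCA.
Qed.

Lemma sqnormE n (x : 'cV[R]_n) : bil 1%:M x x = \sum_i x i 0 ^+ 2.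
Proof.
rewrite /bil mulmx1 mxE; apply: eq_bigr => i _.
by rewrite mxE expr2.
Qed.

Lemma sqnorm_ge0 n (x : 'cV[R]_n) : 0 <= bil 1%:M x x.
Proof. by rewrite sqnormE sumr_ge0 // => i _; rewrite sqr_ge0. Qed.

Lemma sqnorm_gt0 n (x : 'cV[R]_n) : x != 0 -> 0 < bil 1%:M x x.
Proof.
move=> x0; rewrite lt_def sqnorm_ge0 andbT; apply: contra x0.
rewrite sqnormE psumr_eq0; last by move=> i _; rewrite sqr_ge0.
move=> /allP h; apply/eqP/colP => i; rewrite mxE.
by have := h i (mem_index_enum i); rewrite sqrf_eq0 => /eqP.
Qed.

Lemma posdef_ge0 n (P : 'M[R]_n) u : posdef P -> 0 <= bil P u u.
Proof.
case=> _ h; have [->|u0] := eqVneq u 0; first by rewrite bil0l.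
exact/ltW/h.
Qed.

Lemma posdef_eq0 n (P : 'M[R]_n) u : posdef P -> bil P u u <= 0 -> u = 0.
Proof.
case=> _ h hu; apply: contraTeq hu => u0; rewrite -ltNge; exact: h.
Qed.

Lemma posdef_unitmx n (P : 'M[R]_n) : posdef P -> P \in unitmx.
Proof.
move=> pP; rewrite -row_free_unit -kermx_eq0; apply/eqP/row_matrixP => i.
rewrite row0; apply: trmx_inj; rewrite trmx0; apply: (posdef_eq0 pP).
rewrite /bil trmxK; suff -> : row i (kermx P) *m P = 0 by rewrite mul0mx mxE.
by apply/sub_kermxP; rewrite row_sub.
Qed.

Lemma cauchy_schwarz_semidef n (S : 'M[R]_n) u v :
  possemidef S -> 0 < bil S v v -> bil S v u ^+ 2 <= bil S u u * bil S v v.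
Proof.
move=> [sS hS] c0; set b := bil S v u; set c := bil S v v in c0 *.
have : 0 <= bil S (u - (b / c) *: v) (u - (b / c) *: v) by exact: hS.
rewrite bilDl !bilDr !bilNl !bilNr !bilZl !bilZr (bil_sym u v) // -/b -/c.
have -> : bil S u u - b / c * b + (- (b / c * b) - - (b / c * (b / c * c)))
   = (bil S u u * c - b ^+ 2) / c by field; rewrite gt_eqF.
by rewrite pmulr_lge0 ?invr_gt0 // subr_ge0.
Qed.

End Bilinear.

(** * The S-lemma *)

Section SLemma.
Variable R : realType.

(** On the line x + t y the form N has two roots t, of opposite signs, and M is
    nonnegative at both points.  The convex combination of the two inequalities
    that removes the term linear in t is the conclusion. *)
Lemma s_lemma_pair n (M N : 'M[R]_n) x y :
  (forall z, 0 <= bil N z z -> 0 <= bil M z z) ->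
  bil N x x < 0 -> 0 < bil N y y ->
  bil N x x * bil M y y <= bil M x x * bil N y y.
Proof.
move=> h; set c := bil N x x; set a := bil N y y => c0 a0.
pose b := bil N x y + bil N y x; pose d := Num.sqrt (b ^+ 2 - 4 * a * c).
have ac : a * c < 0 by rewrite pmulr_rlt0.
have dE : d ^+ 2 = b ^+ 2 - 4 * a * c by rewrite sqr_sqrtr //; nra.
have d0 : 0 <= d by rewrite sqrtr_ge0.
have expand (A : 'M[R]_n) t : bil A (x + t *: y) (x + t *: y)
    = bil A x x + t * (bil A x y + bil A y x) + t ^+ 2 * bil A y y.
  by rewrite bilDl !bilDr !bilZl !bilZr; ring.
have root e : e ^+ 2 = 1 -> let t := (- b + e * d) / (2 * a) in
    0 <= bil M x x + t * (bil M x y + bil M y x) - (b * t + c) / a * bil M y y.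
  move=> e2; set t := (_ / _) => /=; have a0' : a != 0 by rewrite gt_eqF.
  (* t is a root of N(x + t y) = a t^2 + b t + c. *)
  have tE : t ^+ 2 = - ((b * t + c) / a).
    suff : a * t ^+ 2 + b * t + c = 0.
      move=> E.
      have -> : t ^+ 2 = (a * t ^+ 2 + b * t + c) / a - (b * t + c) / a.
        by field.
      by rewrite E mul0r sub0r.
    rewrite /t; have -> : a * ((- b + e * d) / (2 * a)) ^+ 2
        + b * ((- b + e * d) / (2 * a)) + c
        = (e ^+ 2 * d ^+ 2 - b ^+ 2 + 4 * a * c) / (4 * a) by field.
    by rewrite e2 dE; field.
  have := h (x + t *: y); rewrite !expand -/a -/b -/c tE.
  have -> : c + t * b + - ((b * t + c) / a) * a = 0 by field.
  by rewrite mulNr lexx => /(_ isT).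
have l1 := root 1 (expr1n _ _); have l2 := root (-1) (sqrr_sign _ 1).
have bd : `|b| < d.
  by rewrite -ltr_sqr ?nnegrE // ?dE ?real_normK ?num_real //; lra.
move: bd; rewrite ltr_norml => /andP[bd1 bd2].
(* The roots are (- b + d) / (2 a) and (- b - d) / (2 a), so the weights d + b
   and d - b cancel the terms linear in t. *)
have w1 : 0 <= d + b by lra.
have w2 : 0 <= d - b by lra.
have := addr_ge0 (mulr_ge0 w1 l1) (mulr_ge0 w2 l2).
rewrite /= mul1r.
set e := (X in 0 <= X).
have -> : e = 2 * d / a * (bil M x x * a - c * bil M y y).
  by rewrite /e; field; rewrite gt_eqF.
rewrite pmulr_rge0 ?subr_ge0 // divr_gt0 // mulr_gt0 //; lra.
Qed.

(** By [s_lemma_pair], each ratio M/N at a point with N < 0 is at most each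
    ratio at a point with N > 0; the infimum of the latter ratios is a multiplier. *)
Lemma s_lemma_nonstrict n (M N : 'M[R]_n) y0 :
  0 < bil N y0 y0 ->
  (forall z, 0 <= bil N z z -> 0 <= bil M z z) ->
  exists2 a, 0 <= a & forall z, a * bil N z z <= bil M z z.
Proof.
move=> y0P h.
pose E := [set r | exists2 y, 0 < bil N y y & r = bil M y y / bil N y y]%classic.
have E0 : (E !=set0)%classic by exists (bil M y0 y0 / bil N y0 y0); exists y0.
have lb0 : lbound E 0.
  by move=> _ [y yP ->]; rewrite divr_ge0 // ?h // ltW.
exists (inf E) => [|z]; first exact: lb_le_inf.
have [zN|zN|zN] := ltgtP (bil N z z) 0.
- rewrite -ler_ndivrMr //; apply: lb_le_inf => // _ [y yP ->].
  rewrite ler_pdivlMr // mulrAC ler_ndivrMr // mulrC.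
  exact: s_lemma_pair.
- rewrite -ler_pdivlMr //; apply: ge_inf; first by exists 0.
  by exists z.
- by rewrite zN mulr0 h // zN.
Qed.

(** Row vectors, because the compactness results that follow are about them. *)
Lemma continuous_form n (A : 'M[R]_n) :
  continuous (fun v : 'rV[R]_n => bil A v^T v^T).
Proof.
have csum (I : Type) (r : seq I) (F : I -> 'rV[R]_n -> R) :
    (forall i, continuous (F i)) -> continuous (fun v => \sum_(i <- r) F i v).
  move=> cF v; elim: r => [|i r IH].
    rewrite (_ : (fun _ => _) = cst 0); first exact: cst_continuous.
    by apply/funext => w; rewrite big_nil.
  rewrite (_ : (fun _ => _) = F i \+ (fun w => \sum_(j <- r) F j w)).
    apply: continuousD => //; exact: cF.
  by apply/funext => w; rewrite big_cons.
have ccoord i : continuous (fun v : 'rV[R]_n => v^T i 0).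
  rewrite (_ : (fun _ => _) = fun v : 'rV[R]_n => v 0 i).
    exact: coord_continuous.
  by apply/funext => v; rewrite mxE.
rewrite (_ : (fun _ => _) =
    fun v => \sum_j (\sum_i v^T i 0 * A i j) * v^T j 0); last first.
  by apply/funext => v; rewrite bilE.
apply: (@csum) => j v; apply: continuousM; last exact: ccoord.
apply: (@csum) => i {}v.
by apply: continuousM; [exact: ccoord|exact: cst_continuous].
Qed.

Lemma compact_unit_sphere n :
  compact [set v : 'rV[R]_n | bil 1%:M v^T v^T = 1]%classic.
Proof.
apply: (@subclosed_compact _ _
  [set v : 'rV[R]_n | forall i, v ord0 i \in `[-1, 1]%R]%classic).
- have /continuous_closedP cf := @continuous_form n 1%:M.
  exact: (cf [set 1]%classic (@closed_eq _ _)).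
- apply: (@rV_compact R n (fun=> `[-1, 1]%classic)) => _.
  exact: segment_compact.
- move=> v /= vE i; rewrite in_itv /= -ler_norml -(@ler_sqr R) ?nnegrE //.
  rewrite real_normK ?num_real // expr1n -vE sqnormE (bigD1 i) //= mxE.
  by rewrite lerDl sumr_ge0 // => j _; rewrite sqr_ge0.
Qed.

(** The hypothesis makes max(M, - N) positive on the unit sphere, so that its
    minimum there is positive; half of that minimum is the gap. *)
Lemma cone_gap n (M N : 'M[R]_n) :
  (forall z, z != 0 -> 0 <= bil N z z -> 0 < bil M z z) ->
  exists2 e, 0 < e & forall z, 0 <= bil (N + e%:M) z z ->
    0 <= bil (M - e%:M) z z.
Proof.
move=> h.
have [[x0 x00]|allz] := pselect (exists x : 'cV[R]_n, x != 0); last first.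
  exists 1 => // z _; suff -> : z = 0 by rewrite bil0l.
  by apply: contrapT => /eqP z0; apply: allz; exists z.
pose S := [set v : 'rV[R]_n | bil 1%:M v^T v^T = 1]%classic.
have norm1 x : x != 0 -> S ((Num.sqrt (bil 1%:M x x))^-1 *: x)^T.
  move=> /sqnorm_gt0 xP; rewrite /S /= trmxK bilZl bilZr mulrA -expr2 exprVn.
  by rewrite sqr_sqrtr ?ltW // mulVf // gt_eqF.
pose f (v : 'rV[R]_n) := Num.max (bil M v^T v^T) (- bil N v^T v^T).
have cf : continuous f.
  move=> v; apply: (continuous_max (@continuous_form n M v)).
  by apply: continuousN; exact: continuous_form.
have [|c cS cmin] :=
    @EVT_min_rV R n f S _ (@compact_unit_sphere n) (continuous_subspaceT cf).
  by eexists; exact: norm1 x00.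
have c0 : 0 < f c.
  rewrite /f lt_max oppr_gt0; case: ltP => //= cM; rewrite ltNge.
  apply/negP => cN; move: cM; apply/negP; rewrite -ltNge; apply: h => //.
  apply: contraPneq (set_mem cS) => cE.
  by rewrite /S /= cE bil0l => /esym/eqP; rewrite oner_eq0.
exists (f c / 2) => [|z]; first by rewrite divr_gt0.
have [->|z0] := eqVneq z 0; first by rewrite !bil0l.
rewrite !(bil_addmx, bil_oppmx, bil_scalar_mx (f c / 2)).
have := cmin _ (mem_set (norm1 z z0)); rewrite [X in _ <= X]/f trmxK.
rewrite !bilZl !bilZr !mulrA -expr2 exprVn sqr_sqrtr ?sqnorm_ge0 //.
have := sqnorm_gt0 z0; set s := bil 1%:M z z => s0.
rewrite le_max -mulrN ![s^-1 * _]mulrC !ler_pdivlMr // => /orP[]; nra.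
Qed.

(** N is raised by the gap e before [s_lemma_nonstrict] is applied, so the point
    z with N(z) >= 0 becomes one with a positive value. *)
Lemma strict_s_lemma n (M N : 'M[R]_n) :
  (exists2 z, z != 0 & 0 <= bil N z z) ->
  (forall z, z != 0 -> 0 <= bil N z z -> 0 < bil M z z) ->
  exists a b, [/\ 0 <= a, 0 < b &
    forall z, a * bil N z z + b * bil 1%:M z z <= bil M z z].
Proof.
move=> [z0 z0N0 z0N] /cone_gap[e e0 h].
have [|a a0 ha] := @s_lemma_nonstrict n (M - e%:M) (N + e%:M) z0 _ h.
  by rewrite bil_addmx bil_scalar_mx ltr_wpDl // mulr_gt0 // sqnorm_gt0.
exists a, e; split => // z; have := ha z.
rewrite !(bil_addmx, bil_oppmx, bil_scalar_mx e).
by have := mulr_ge0 a0 (mulr_ge0 (ltW e0) (sqnorm_ge0 z)); lra.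
Qed.

End SLemma.

(** * Quadratic matrix inequalities *)

Section QuadraticMatrixInequality.
Variable R : realType.

Definition qmi (n q : nat) (N : 'M[R]_(n + q)) (Z : 'M[R]_(n, q)) : 'M[R]_n :=
  (col_mx 1%:M Z^T)^T *m N *m col_mx 1%:M Z^T.

Lemma bil_qmi n q (N : 'M[R]_(n + q)) Z v :
  bil (qmi N Z) v v = bil N (col_mx v (Z^T *m v)) (col_mx v (Z^T *m v)).
Proof. by rewrite /qmi bil_mulmxr bil_mulmxl trmxK mul_col_mx mul1mx. Qed.

Lemma trmx_qmi n q (N : 'M[R]_(n + q)) Z : N^T = N -> (qmi N Z)^T = qmi N Z.
Proof. by move=> sN; rewrite /qmi !trmx_mul trmxK sN mulmxA. Qed.

(** The rank one matrix D = S v z' / (v'Sv) works, by the Cauchy-Schwarz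
    inequality for S; when v'Sv = 0, also z = 0 and D = 0 works. *)
Lemma dominated_interpolation n q (S : 'M[R]_n) (Q : 'M[R]_q) v z :
  possemidef S -> posdef Q -> bil Q z z <= bil S v v ->
  exists D : 'M[R]_(n, q),
    D^T *m v = z /\ forall u, bil Q (D^T *m u) (D^T *m u) <= bil S u u.
Proof.
move=> pS pQ zv; have := posdef_ge0 z pQ => z0.
have [c0|c0] := ltP 0 (bil S v v); last first.
  have -> : z = 0 by apply: (posdef_eq0 pQ); lra.
  by exists 0; rewrite trmx0 mul0mx; split=> // u; rewrite mul0mx bil0l pS.2.
set c := bil S v v in zv c0 *.
have DE u : (c^-1 *: (S *m v *m z^T))^T *m u = (bil S v u / c) *: z.
  rewrite linearZ /= !trmx_mul trmxK pS.1 -scalemxAl -!mulmxA [v^T *m _]mulmxA.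
  by rewrite [v^T *m _ *m u]mx11_scalar mul_mx_scalar scalerA mulrC.
exists (c^-1 *: (S *m v *m z^T)); split=> [|u].
  by rewrite DE divff ?gt_eqF // scale1r.
rewrite DE bilZl bilZr.
have := cauchy_schwarz_semidef u pS c0; rewrite -/c.
set b := bil S v u => cs; apply: (@le_trans _ _ (b / c * (b / c * c))).
  have -> : b / c * (b / c * bil Q z z) = (b / c) ^+ 2 * bil Q z z by ring.
  by rewrite mulrA -expr2 ler_wpM2l // sqr_ge0.
have -> : b / c * (b / c * c) = b ^+ 2 / c by field; rewrite gt_eqF.
by rewrite ler_pdivrMr.
Qed.

(** Completing the square gives N(v, y) = v'Sv - (y - C'v)'Q(y - C'v), where
    Q = - N22.  A solution Z0 of the inequality makes S positive semidefinite,
    and [dominated_interpolation] provides the deviation of Z from C. *)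
Lemma qmi_interpolation n q (N : 'M[R]_(n + q)) v y :
  N^T = N -> posdef (- drsubmx N) -> (exists Z, possemidef (qmi N Z)) ->
  0 <= bil N (col_mx v y) (col_mx v y) ->
  exists2 Z, possemidef (qmi N Z) & Z^T *m v = y.
Proof.
move=> sN; set Q := - drsubmx N => pQ [Z0 pZ0] Nvy.
set N11 := ulsubmx N; set N12 := ursubmx N.
pose C := N12 *m invmx Q.
have QC : C *m Q = N12 by rewrite /C mulmxKV // posdef_unitmx.
(* Only QC is used of C from here on, and trmx_mul must not split C. *)
clearbody C; pose S := N11 + C *m Q *m C^T.
have sN11 : N11^T = N11 by rewrite /N11 trmx_ulsub sN.
have sN12 : dlsubmx N = N12^T by rewrite /N12 trmx_ursub sN.
have sq u w : bil N (col_mx u w) (col_mx u w)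
    = bil S u u - bil Q (w - C^T *m u) (w - C^T *m u).
  have CQ a b : bil Q (C^T *m a) b = bil N12 a b by rewrite -bil_mulmxl QC.
  rewrite -[N]submxK bil_block sN12 -/N11 -/N12 bil_trmx.
  rewrite !(bilDl, bilDr, bilNl, bilNr) CQ (bil_sym w _ pQ.1) !CQ.
  rewrite bil_addmx bil_mulmxr QC.
  by rewrite [bil Q w w]bil_oppmx; ring.
have pS : possemidef S.
  split; first by rewrite /S linearD /= sN11 !trmx_mul trmxK pQ.1 mulmxA.
  move=> u; have := pZ0.2 u; rewrite -[_ 0 0]/(bil _ u u) bil_qmi sq.
  have := posdef_ge0 (Z0^T *m u - C^T *m u) pQ.
  rewrite -[(u^T *m S *m u) 0 0]/(bil _ u u); lra.
have [|D [Dv hD]] := @dominated_interpolation n q S Q v (y - C^T *m v) pS pQ _.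
  by rewrite -subr_ge0 -sq.
exists (C + D); last by rewrite linearD /= mulmxDl Dv subrKC.
split=> [|u]; first exact: trmx_qmi.
rewrite -[_ 0 0]/(bil _ u u) bil_qmi sq subr_ge0.
by rewrite linearD /= mulmxDl addrC addKr.
Qed.

End QuadraticMatrixInequality.

(** * Block sparsity *)

Section BlockStructure.
Variable R : realType.

Definition block_index k m (p : 'I_k -> nat) (hp : m = (\sum_(i < k) p i)%N)
    (a : 'I_m) : 'I_k := tagnat.sig1 (cast_ord hp a).

Lemma structuredP k l m n (p : 'I_k -> nat) (q : 'I_l -> nat)
    (hp : m = (\sum_(i < k) p i)%N) (hq : n = (\sum_(j < l) q j)%N)
    (sigma : 'M[bool]_(k, l)) (M : 'M[R]_(m, n)) :
  structured hp hq sigma M <->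
  (forall a b, sigma (block_index hp a) (block_index hq b) = false ->
    M a b = 0).
Proof.
rewrite /block_index; subst m n; rewrite /structured castmx_id.
split=> [h a b|h i j s0].
  rewrite !cast_ord_id => /h /matrixP /(_ (tagnat.sig2 a) (tagnat.sig2 b)).
  by rewrite !mxE !tagnat.sig2K.
apply/matrixP => a b; rewrite !mxE; apply: h.
by rewrite !cast_ord_id !tagnat.Rank1K.
Qed.

Lemma structured_idP l n (q : 'I_l -> nat) (hq : n = (\sum_(j < l) q j)%N)
    (P : 'M[R]_n) :
  structured hq hq (id_structure l) P <->
  (forall a b, block_index hq a != block_index hq b -> P a b = 0).
Proof.
rewrite structuredP; split=> h a b.
  by move=> ab; apply: h; rewrite mxE; apply/negbTE.
by rewrite mxE => /negbT; exact: h.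
Qed.

Lemma structured_mulmx k l m n (p : 'I_k -> nat) (q : 'I_l -> nat)
    (hp : m = (\sum_(i < k) p i)%N) (hq : n = (\sum_(j < l) q j)%N)
    (sigma : 'M[bool]_(k, l)) (M : 'M[R]_(m, n)) (P : 'M[R]_n) :
  structured hp hq sigma M -> structured hq hq (id_structure l) P ->
  structured hp hq sigma (M *m P).
Proof.
move=> /structuredP hM /structured_idP hP; apply/structuredP => a b s0.
rewrite mxE big1 // => c _.
have [cb|cb] := eqVneq (block_index hq c) (block_index hq b).
  by rewrite hM ?mul0r // cb.
by rewrite hP ?mulr0.
Qed.

(** P is block diagonal if and only if it commutes with the diagonal indicator
    matrices of the blocks, and then so does its inverse. *)
Lemma structured_invmx l n (q : 'I_l -> nat) (hq : n = (\sum_(j < l) q j)%N)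
    (P : 'M[R]_n) :
  P \in unitmx -> structured hq hq (id_structure l) P ->
  structured hq hq (id_structure l) (invmx P).
Proof.
move=> uP /structured_idP hP; apply/structured_idP => a b ab.
pose d : 'rV[R]_n := \row_c (block_index hq c == block_index hq b)%:R.
have PD : P *m diag_mx d = diag_mx d *m P.
  apply/matrixP => i j; rewrite mul_mx_diag mul_diag_mx !mxE.
  have [->|ij] := eqVneq (block_index hq i) (block_index hq j).
    by rewrite mulrC.
  by rewrite hP // mulr0 mul0r.
have : invmx P *m diag_mx d = diag_mx d *m invmx P.
  by rewrite -[RHS](mulKmx uP) [P *m _]mulmxA PD mulmxK.
move=> /matrixP/(_ a b); rewrite mul_mx_diag mul_diag_mx !mxE eqxx mulr1.
by rewrite (negbTE ab) mul0r.
Qed.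

End BlockStructure.

(** * The linear matrix inequality *)

Section DataDrivenStabilization.
Variable R : realType.

Lemma compatibleE n m T (B : 'M[R]_(n, m)) Phi (U : 'M_(m, T)) X A :
  compatible B Phi U X A <-> possemidef (qmi (data_mx B Phi U X) A).
Proof.
rewrite /compatible /noise_bound /qmi /data_mx.
set F := block_mx _ _ _ _.
suff -> : col_mx 1%:M (Xplus X - A *m Xminus X - B *m U)^T
    = F^T *m col_mx 1%:M A^T by rewrite trmx_mul trmxK !mulmxA.
rewrite tr_block_mx mul_block_col !trmx0 trmx1 mul0mx addr0 mulmx1 mulmx1.
congr col_mx; rewrite -[in RHS](trmxK (_ + _)); congr trmx.
by rewrite linearD /= trmxK linearN /= mulNmx linearN /= trmx_mul !trmxK addrAC.
Qed.

Lemma trmx_data_mx n m T (B : 'M[R]_(n, m)) Phi (U : 'M_(m, T)) X :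
  Phi^T = Phi -> (data_mx B Phi U X)^T = data_mx B Phi U X.
Proof. by move=> sPhi; rewrite /data_mx !trmx_mul trmxK sPhi mulmxA. Qed.

Lemma drsubmx_data_mx n m T (B : 'M[R]_(n, m)) Phi (U : 'M_(m, T)) X :
  drsubmx (data_mx B Phi U X) = Xminus X *m drsubmx Phi *m (Xminus X)^T.
Proof.
rewrite /data_mx -[Phi in LHS]submxK tr_block_mx !mulmx_block block_mxKdr.
by rewrite trmx0 mulmx0 mul0mx !add0r linearN /= mulNmx mulmxN mulNmx opprK.
Qed.

(** The completed square g + h stands for the Schur complement with respect to
    the lower right block P. *)
Lemma lmi_form n m (B : 'M[R]_(n, m)) N (P : 'M_n) (K : 'M_(m, n)) a b v y g :
  P^T = P ->
  let h := (B *m K)^T *m v + y in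
  bil (lmi_mx B N P (K *m P) a b) (col_mx (col_mx v y) g) (col_mx (col_mx v y) g)
  = bil P v v - bil P h h - a * bil N (col_mx v y) (col_mx v y)
    - b * bil 1%:M v v + bil P (g + h) (g + h).
Proof.
move=> sP h; rewrite /lmi_mx bil_addmx bil_oppmx bil_scalemx !bil_block.
rewrite !bil_zeromx !addr0 bil_addmx bil_oppmx (bil_scalar_mx b).
have e1 : bil (col_mx (B *m (K *m P)) P) (col_mx v y) g = bil P h g.
  rewrite /bil tr_col_mx mul_row_col !mulmxDl /h linearD /= trmx_mul trmxK.
  by rewrite !mulmxDl !mulmxA.
have -> : row_mx ((K *m P)^T *m B^T) P = (col_mx (B *m (K *m P)) P)^T.
  by rewrite tr_col_mx sP !trmx_mul sP.
rewrite bil_trmx e1; clearbody h; rewrite !bilDl !bilDr (bil_sym g h sP); ring.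
Qed.

Lemma trmx_lmi_mx n m (B : 'M[R]_(n, m)) N (P : 'M_n) (L : 'M_(m, n)) a b :
  N^T = N -> P^T = P -> (lmi_mx B N P L a b)^T = lmi_mx B N P L a b.
Proof.
move=> sN sP; rewrite /lmi_mx linearB linearZ /= !tr_block_mx sN !trmx0.
by rewrite linearB /= tr_scalar_mx sP tr_col_mx tr_row_mx !trmx_mul !trmxK sP.
Qed.

Lemma bil_closed_loop n m (B : 'M[R]_(n, m)) (P A : 'M_n) (K : 'M_(m, n)) v :
  let h := (B *m K)^T *m v + A^T *m v in
  bil (P - (A + B *m K) *m P *m (A + B *m K)^T) v v = bil P v v - bil P h h.
Proof.
move=> h; rewrite bil_addmx bil_oppmx bil_mulmxr bil_mulmxl.
by rewrite linearD /= mulmxDl addrC [X in bil P X X]addrC addrC.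
Qed.

Lemma trmx_closed_loop n (P C : 'M[R]_n) : P^T = P ->
  (P - C *m P *m C^T)^T = P - C *m P *m C^T.
Proof. by move=> sP; rewrite linearB /= !trmx_mul trmxK sP mulmxA. Qed.

(** The LMI is evaluated at (v, A'v, - (A+BK)'v), where the completed square of
    [lmi_form] vanishes. *)
Lemma lmi_stabilizes n m (B : 'M[R]_(n, m)) N (P : 'M_n) (K : 'M_(m, n))
    (a b : R) A :
  posdef P -> 0 <= a -> 0 < b -> possemidef (lmi_mx B N P (K *m P) a b) ->
  possemidef (qmi N A) -> posdef (P - (A + B *m K) *m P *m (A + B *m K)^T).
Proof.
move=> pP a0 b0 [_ lmi] [_ NA]; split=> [|v v0].
  exact/trmx_closed_loop/pP.1.
rewrite -[_ 0 0]/(bil _ v v) bil_closed_loop.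
set h := (B *m K)^T *m v + A^T *m v.
have := lmi (col_mx (col_mx v (A^T *m v)) (- h)).
rewrite -[_ 0 0]/(bil _ _ _) lmi_form ?pP.1 // -/h [- h + h]addNr bil0l addr0.
have := NA v; rewrite -[_ 0 0]/(bil _ v v) bil_qmi => NAv.
have := mulr_ge0 a0 NAv; have := mulr_gt0 b0 (sqnorm_gt0 v0); lra.
Qed.

(** Adding s y y' to A does not change A X if X'y = 0.  It moves the vector
    (A+BK)'y by a multiple of y; for the shifts y and - y the two Lyapunov
    inequalities add up to a contradiction. *)
Lemma stabilized_unexcited n m q (B : 'M[R]_(n, m)) (P A : 'M_n)
    (K : 'M_(m, n)) (X : 'M_(n, q)) (y : 'cV[R]_n) :
  posdef P ->
  (forall A', A' *m X = A *m X ->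
    posdef (P - (A' + B *m K) *m P *m (A' + B *m K)^T)) ->
  X^T *m y = 0 -> y = 0.
Proof.
move=> pP st Xy; apply/eqP; apply: contraT => y0.
have yX : y^T *m X = 0 by rewrite -[LHS]trmxK trmx_mul trmxK Xy trmx0.
have perturb s : 0 < bil P y y
    - bil P ((A + B *m K)^T *m y + (s * bil 1%:M y y) *: y)
            ((A + B *m K)^T *m y + (s * bil 1%:M y y) *: y).
  have [|_ /(_ y y0)] := st (A + s *: (y *m y^T)) _.
    by rewrite mulmxDl -scalemxAl -mulmxA yX mulmx0 scaler0 addr0.
  rewrite -[_ 0 0]/(bil _ y y) bil_closed_loop.
  suff -> : (B *m K)^T *m y + (A + s *: (y *m y^T))^T *m y
    = (A + B *m K)^T *m y + (s * bil 1%:M y y) *: y by [].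
  have -> : (A + s *: (y *m y^T))^T = A^T + s *: (y *m y^T).
    by rewrite linearD linearZ /= trmx_mul trmxK.
  rewrite [(A + B *m K)^T]linearD /= !mulmxDl -scalemxAl -mulmxA.
  rewrite [y^T *m y]mx11_scalar mul_mx_scalar scalerA addrCA addrA.
  by rewrite /bil mulmx1.
have yP := sqnorm_gt0 y0.
have := perturb (bil 1%:M y y)^-1; have := perturb (- (bil 1%:M y y)^-1).
rewrite mulNr mulVf ?gt_eqF // scaleN1r scale1r.
set x := _ *m y; rewrite !(bilDl, bilDr, bilNl, bilNr).
by have := posdef_ge0 x pP; have := posdef_ge0 y pP; lra.
Qed.

(** If (v, y) is nonzero and N(v, y) >= 0, then y = A'v for a solution A
    and v is nonzero, so M(v, y) > 0 by stability of A.  This is the hypothesis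
    of the strict S-lemma. *)
Lemma stabilized_lmi n m (B : 'M[R]_(n, m)) N (P : 'M_n) (K : 'M_(m, n)) :
  N^T = N -> posdef (- drsubmx N) -> (exists A, possemidef (qmi N A)) ->
  posdef P ->
  (forall A, possemidef (qmi N A) ->
    posdef (P - (A + B *m K) *m P *m (A + B *m K)^T)) ->
  exists a b, [/\ 0 <= a, 0 < b & possemidef (lmi_mx B N P (K *m P) a b)].
Proof.
move=> sN pQ exA pP st.
pose G : 'M[R]_(n + n, n) := col_mx (B *m K) 1%:M.
pose M := block_mx P 0 0 0 - G *m P *m G^T.
have ME v y : let h := (B *m K)^T *m v + y in
    bil M (col_mx v y) (col_mx v y) = bil P v v - bil P h h.
  rewrite /= bil_addmx bil_oppmx bil_mulmxr bil_mulmxl bil_block !bil_zeromx.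
  by rewrite /G tr_col_mx trmx1 mul_row_col mul1mx !addr0.
have cone z : z != 0 -> 0 <= bil N z z -> 0 < bil M z z.
  rewrite -[z]vsubmxK; set v := usubmx z; set y := dsubmx z => z0 Nz.
  have [A NA Av] := qmi_interpolation sN pQ exA Nz.
  have v0 : v != 0.
    apply: contraNneq z0 => v0; rewrite -Av v0 mulmx0; apply/eqP.
    exact: col_mx0.
  by rewrite ME -Av -bil_closed_loop; apply: (st A NA).2.
(* N >= 0 at some nonzero vector, unless n = 0. *)
have [z0|n0] := pselect (exists2 z, z != 0 & 0 <= bil N z z).
  have [a [b [a0 b0 hab]]] := strict_s_lemma z0 cone.
  exists a, b; split=> //; split; first exact: trmx_lmi_mx sN pP.1.
  move=> z; rewrite -[z]vsubmxK -[usubmx z]vsubmxK -[_ 0 0]/(bil _ _ _).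
  set v := usubmx _; set y := dsubmx _; set g := dsubmx _.
  rewrite lmi_form ?pP.1 //; set h := _ + y.
  have := hab (col_mx v y); rewrite ME -/h.
  have -> : bil 1%:M (col_mx v y) (col_mx v y) = bil 1%:M v v + bil 1%:M y y.
    by rewrite scalar_mx_block bil_block !bil_zeromx !addr0.
  have := posdef_ge0 (g + h) pP.
  have := mulr_ge0 (ltW b0) (sqnorm_ge0 y); lra.
exists 0, 1; split=> //; split; first exact: trmx_lmi_mx sN pP.1.
have [A [_ NA]] := exA.
have zero (v : 'cV[R]_n) : v = 0.
  apply: contrapT => /eqP v0; apply: n0; exists (col_mx v (A^T *m v)).
    by apply: contra_neq v0 => /eqP; rewrite col_mx_eq0 => /andP[/eqP].
  by rewrite -bil_qmi; exact: NA.
move=> z; rewrite -[z]vsubmxK -[usubmx z]vsubmxK [usubmx _]zero.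
by rewrite [dsubmx _]zero [dsubmx z]zero !col_mx0 mulmx0 mxE.
Qed.

End DataDrivenStabilization.

(** * The measured signals *)

Section Signals.
Variable R : realType.

Lemma Xplus_signal n T (x : nat -> 'cV[R]_n) :
  Xplus (signal_mx T.+1 x) = signal_mx T (fun t => x t.+1).
Proof. by apply/matrixP => i t; rewrite !mxE. Qed.

Lemma Xminus_signal n T (x : nat -> 'cV[R]_n) :
  Xminus (signal_mx T.+1 x) = signal_mx T x.
Proof. by apply/matrixP => i t; rewrite !mxE lift_max. Qed.

Lemma mulmx_signal n m T (A : 'M[R]_(n, m)) (x : nat -> 'cV[R]_m) :
  A *m signal_mx T x = signal_mx T (fun t => A *m x t).
Proof.
by apply/matrixP => i t; rewrite !mxE; apply: eq_bigr => j _; rewrite mxE.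
Qed.

Lemma signal_residual n m T (A : 'M[R]_n) (B : 'M[R]_(n, m))
    (x w : nat -> 'cV[R]_n) (u : nat -> 'cV[R]_m) :
  (forall t, (t < T)%N -> x t.+1 = A *m x t + B *m u t + w t) ->
  Xplus (signal_mx T.+1 x) - A *m Xminus (signal_mx T.+1 x)
    - B *m signal_mx T u = signal_mx T w.
Proof.
move=> sys; rewrite Xplus_signal Xminus_signal !mulmx_signal.
by apply/matrixP => i t; rewrite !mxE sys // !mxE; ring.
Qed.

End Signals.

Unset Implicit Arguments.

(** * Informativity and the linear matrix inequality *)

Theorem mainTheorem3 (R : realType)
  (n m r : nat) (na ma : 'I_r -> nat)
  (hn : n = (\sum_(i < r) na i)%N) (hm : m = (\sum_(i < r) ma i)%N)
  (Bs : forall i : 'I_r, 'M[R]_(na i, ma i))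
  (As : 'M[R]_n) (B : 'M[R]_(n, m))
  (hB : castmx (hn, hm) B = block_diag Bs)
  (T : nat)
  (Phi11 : 'M[R]_n) (Phi12 : 'M[R]_(n, T)) (Phi22 : 'M[R]_T)
  (hPhi11 : Phi11^T = Phi11) (hPhi22 : Phi22^T = Phi22)
  (hneg : negdef Phi22)
  (x w : nat -> 'cV[R]_n) (u : nat -> 'cV[R]_m)
  (hsys : forall t : nat, (t < T)%N -> x t.+1 = As *m x t + B *m u t + w t)
  (hnoise : noise_bound (noise_mx Phi11 Phi12 Phi22) (signal_mx T w))
  (k l : nat) (p : 'I_k -> nat) (q : 'I_l -> nat)
  (hp : m = (\sum_(i < k) p i)%N) (hq : n = (\sum_(j < l) q j)%N)
  (sigma : 'M[bool]_(k, l)) :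
  let Phi := noise_mx Phi11 Phi12 Phi22 in
  let X := signal_mx T.+1 x in
  let U := signal_mx T u in
  informative hp hq sigma B Phi U X <->
  exists (P : 'M[R]_n) (L : 'M[R]_(m, n)) (alpha beta : R),
    [/\ structured hq hq (id_structure l) P /\ posdef P,
        structured hp hq sigma L,
        0 <= alpha,
        0 < beta
      & possemidef (lmi_mx B (data_mx B Phi U X) P L alpha beta)].
Proof.
move=> Phi X U; set N := data_mx B Phi U X.
have sPhi : Phi^T = Phi.
  by rewrite /Phi /noise_mx tr_block_mx trmxK hPhi11 hPhi22.
have sN : N^T = N by exact: trmx_data_mx.
have /compatibleE As_ok : compatible B Phi U X As.
  by rewrite /compatible /X /U (signal_residual hsys).
split=> [[K [P [sK sP pP st]]]|[P [L [a [b [[sP pP] sL a0 b0 lmi]]]]]].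
- have stN A : possemidef (qmi N A) ->
      posdef (P - (A + B *m K) *m P *m (A + B *m K)^T).
    by move=> NA; apply: st; exact/compatibleE.
  have pN22 : posdef (- drsubmx N).
    rewrite drsubmx_data_mx /Phi /noise_mx block_mxKdr.
    split; first by rewrite linearN /= !trmx_mul trmxK hPhi22 mulmxA.
    move=> y y0; rewrite -[_ 0 0]/(bil _ y y) bil_oppmx bil_mulmxr bil_mulmxl.
    rewrite -bil_oppmx; apply: hneg.2; apply: contra_neq y0.
    apply: (stabilized_unexcited pP (A := As)) => A AX; apply: st.
    by rewrite /compatible AX (signal_residual hsys).
  have [a [b [a0 b0 lmi]]] :=
    stabilized_lmi sN pN22 (ex_intro _ As As_ok) pP stN.
  by exists P, (K *m P), a, b; split=> //; exact: structured_mulmx sK sP.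
- have uP := posdef_unitmx pP.
  exists (L *m invmx P), P; split=> //.
    by apply: structured_mulmx sL _; exact: structured_invmx.
  move=> A /compatibleE NA; apply: (lmi_stabilizes pP a0 b0 _ NA).
  by rewrite mulmxKV.
Qed.
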